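(* Let $m<n$ be positive integers, $\gamma\in\mathbb{R}$, $\Psi\in\mathbb{R}^{n\times m}$ of full column rank, $M\in\mathbb{R}^{m\times m}$ symmetric and invertible, and let $B=\gamma I+\Psi M^{-1}\Psi^T\in\mathbb{R}^{n\times n}$, with smallest eigenvalue $\lambda_1$. Let $g\in\mathbb{R}^n$, $T=\Psi^T\Psi$ and $\bar u=\Psi^Tg$. Suppose that $V\in\mathbb{R}^{m\times m}$ and the diagonal matrix $\Lambda\in\mathbb{R}^{m\times m}$ satisfy $MV=TV\Lambda$ and $V^TTV=I$. Then for every $\lambda>\max(0,-\lambda_1)$ the solution $s=-(B+\lambda I)^{-1}g$ is given by $$s=-\frac{1}{\lambda+\gamma}\,g-\Psi V r,$$ where $r\in\mathbb{R}^m$ is a vector that can be computed from the data $V,\Lambda,\gamma,\lambda,\bar u$ using $\mathcal{O}(m^2)$ arithmetic operations (with a constant independent of $m$, $n$ and the data).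
   Context: Operation counts are counts of real arithmetic operations (additions, subtractions, multiplications, divisions). The quantities $T=\Psi^T\Psi$ and $\bar u=\Psi^Tg$, and the pair $(V,\Lambda)$ solving the generalized eigenvalue problem $Mv=\lambda Tv$ (normalized by $V^TTV=I$), are assumed already computed and stored, so their cost is not included in the count for $r$. *)

(* Defs.v *)
From HB Require Import structures.
From mathcomp Require Import all_boot all_order all_algebra.
From mathcomp Require Import reals.

Set Implicit Arguments.
Unset Strict Implicit.
Unset Printing Implicit Defensive.

Import Order.TTheory GRing.Theory Num.Theory.

Local Open Scope ring_scope.

(* Straight-line arithmetic programs reading inputs indexed by [I].  Step
   number [k] performs one operation and stores its result in register [k].
   Inputs, integer constants and earlier registers are the only operands, so
   the real data enter a program through its inputs alone. *)
Inductive arith_op := Add | Sub | Mul | Div.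

Inductive operand (I : Type) :=
  | Cst of int
  | Inp of I
  | Reg of nat.

Record instr (I : Type) := Instr {
  instr_op : arith_op;
  instr_arg1 : operand I;
  instr_arg2 : operand I }.

Record slp (I : Type) (m : nat) := Slp {
  slp_steps : seq (instr I);
  slp_out : 'I_m -> operand I }.

(* Reading inputs and constants, and designating outputs, is free. *)
Definition slp_cost (I : Type) (m : nat) (P : slp I m) : nat :=
  size (slp_steps P).

Section Semantics.
Variables (R : realType) (I : Type) (x : I -> R).

(* [None] signals a failure: division by zero, or a register not yet set. *)
Definition eval_op (o : arith_op) (a b : R) : option R :=
  match o with
  | Add => Some (a + b)
  | Sub => Some (a - b)
  | Mul => Some (a * b)
  | Div => if b == 0 then None else Some (a / b)
  end.

Definition eval_operand (regs : seq R) (u : operand I) : option R :=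
  match u with
  | Cst z => Some z%:~R
  | Inp i => Some (x i)
  | Reg k => onth regs k
  end.

Definition eval_instr (regs : seq R) (c : instr I) : option R :=
  match eval_operand regs (instr_arg1 c), eval_operand regs (instr_arg2 c) with
  | Some a, Some b => eval_op (instr_op c) a b
  | _, _ => None
  end.

Fixpoint run (regs : seq R) (cs : seq (instr I)) : option (seq R) :=
  match cs with
  | [::] => Some regs
  | c :: cs' =>
      match eval_instr regs c with
      | Some a => run (rcons regs a) cs'
      | None => None
      end
  end.

Definition slp_computes (m : nat) (P : slp I m) (r : 'cV[R]_m) : Prop :=
  exists2 regs : seq R, run [::] (slp_steps P) = Some regs &
    forall i : 'I_m, eval_operand regs (slp_out P i) = Some (r i ord0).

End Semantics.

Inductive datum (m : nat) :=
  | In_V of 'I_m & 'I_m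
  | In_Lambda of 'I_m & 'I_m
  | In_gamma
  | In_lambda
  | In_ubar of 'I_m.

Definition data (R : realType) (m : nat) (V Lambda : 'M[R]_m)
    (gamma lambda : R) (ubar : 'cV[R]_m) (d : datum m) : R :=
  match d with
  | In_V i j => V i j
  | In_Lambda i j => Lambda i j
  | In_gamma => gamma
  | In_lambda => lambda
  | In_ubar i => ubar i ord0
  end.

Definition smallest_eigenvalue (R : realType) (n : nat) (B : 'M[R]_n)
    (a : R) : Prop :=
  eigenvalue B a /\ forall b : R, eigenvalue B b -> a <= b.

(* Main.v *)
Require Import Defs.
From HB Require Import structures.
From mathcomp Require Import all_boot all_order all_algebra.
From mathcomp Require Import reals.
From mathcomp Require Import zify ring lra.

Set Implicit Arguments.
Unset Strict Implicit.
Unset Printing Implicit Defensive.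

Import Order.TTheory GRing.Theory Num.Theory.

Local Open Scope ring_scope.

(** The generalized eigenvectors diagonalize the low-rank part of [B].
    From [M V = T V Lambda] and [V^T T V = 1] one gets
    [M^-1 = V Lambda^-1 V^T], so with [U := Psi V] the matrix [U^T U] is the
    identity and [B = gamma + U Lambda^-1 U^T].  Matrices of the form
    [a + U diag(d) U^T] with [U^T U = 1] are closed under products
    ([mul_scalar_plus_sandwich]).  Writing [alpha := lambda + gamma] and [l_i]
    for the diagonal entries of [Lambda], the inverse of [B + lambda] therefore
    is [alpha^-1 - U diag(1 / (alpha (alpha l_i + 1))) U^T]
    ([scalar_plus_sandwich_inverse]), and applying it to [g] yields
    [r_i = - (V^T ubar)_i / (alpha (alpha l_i + 1))].

    No denominator vanishes, because [gamma] and all [gamma + l_i^-1] are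
    eigenvalues of [B], hence at least [lambda1], while [lambda > - lambda1].
    That [gamma] is an eigenvalue is where [m < n] enters: a nonzero row vector
    killed by [Psi] exists ([eigenvalue_scalar_plus_low_rank]).

    For the operation count, the program computes [alpha] once and then runs,
    for each [i], a block of [2 m + 5] instructions whose last one produces
    [r_i]; the dominant cost is the [m] inner products in [V^T ubar].  Every
    block needs only the value of [alpha] in register 0 and the index of its
    own first register, so its correctness can be stated for an arbitrary
    register file ([run_coord]) and lifted to the sequence of blocks
    ([run_blocks]). *)

(** * Scalar matrices perturbed by a diagonalized low-rank term *)

Lemma mul_scalar_plus_sandwich (F : fieldType) (n m : nat) (U : 'M[F]_(n, m))
    (a b : F) (d e : 'rV[F]_m) :
  U^T *m U = 1%:M ->
  (a%:M + U *m diag_mx d *m U^T) *m (b%:M + U *m diag_mx e *m U^T) =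
  (a * b)%:M
    + U *m diag_mx (\row_i (a * e 0 i + b * d 0 i + d 0 i * e 0 i)) *m U^T.
Proof.
move=> UU; rewrite mulmxDl !mulmxDr -scalar_mxM -addrA; congr (_ + _).
have -> : U *m diag_mx d *m U^T *m (U *m diag_mx e *m U^T) =
          U *m (diag_mx d *m diag_mx e) *m U^T.
  by rewrite -!mulmxA (mulmxA U^T) UU mul1mx.
rewrite mul_scalar_mx mul_mx_scalar mulmx_diag.
set de := \row_i (d 0 i * e 0 i).
have -> : \row_i (a * e 0 i + b * d 0 i + d 0 i * e 0 i) = a *: e + b *: d + de.
  by apply/rowP => i; rewrite !mxE.
have -> : diag_mx (a *: e + b *: d + de) =
          a *: diag_mx e + b *: diag_mx d + diag_mx de.
  by rewrite !linearD !linearZ.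
rewrite !mulmxDr !mulmxDl -!scalemxAr -!scalemxAl.
by rewrite addrA.
Qed.

(** The coefficient [- 1 / (a (a l_i + 1))] is the solution [x] of
    [a x + a^-1 l_i^-1 + l_i^-1 x = 0], multiplied out so that only [l_i]
    and not its inverse is read. *)
Lemma scalar_plus_sandwich_inverse (F : fieldType) (n m : nat)
    (U : 'M[F]_(n, m)) (a : F) (l : 'rV[F]_m) :
  U^T *m U = 1%:M -> a != 0 ->
  (forall i, l 0 i != 0) -> (forall i, a * l 0 i + 1 != 0) ->
  (a%:M + U *m diag_mx (\row_i (l 0 i)^-1) *m U^T) *m
  (a^-1%:M + U *m diag_mx (\row_i (- (a * (a * l 0 i + 1))^-1)) *m U^T) = 1%:M.
Proof.
move=> UU a0 l0 al0; rewrite mul_scalar_plus_sandwich // divff //.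
set d := \row_i _; suff -> : d = 0 by rewrite linear0 mulmx0 mul0mx addr0.
apply/rowP => i; rewrite !mxE; field.
by rewrite a0 l0 al0.
Qed.

(** The perturbation has rank at most [m < n], so some nonzero row vector does
    not see it. *)
Lemma eigenvalue_scalar_plus_low_rank (F : fieldType) (n m : nat)
    (c : F) (A : 'M[F]_(n, m)) (N : 'M[F]_(m, n)) :
  (m < n)%N -> eigenvalue (c%:M + A *m N) c.
Proof.
move=> mn.
have : kermx A != 0.
  rewrite kermx_eq0 /row_free neq_ltn.
  by rewrite (leq_ltn_trans (rank_leq_col A) mn).
case/rowV0Pn=> v /sub_kermxP vA v0; apply/eigenvalueP; exists v => //.
by rewrite mulmxDr mul_mx_scalar mulmxA vA mul0mx addr0.
Qed.

(** The [i]-th column of [U], transposed, is the eigenvector; it is nonzero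
    because the columns of [U] are orthonormal. *)
Lemma eigenvalue_scalar_plus_sandwich (F : fieldType) (n m : nat)
    (U : 'M[F]_(n, m)) (c : F) (d : 'rV[F]_m) (i : 'I_m) :
  U^T *m U = 1%:M ->
  eigenvalue (c%:M + U *m diag_mx d *m U^T) (c + d 0 i).
Proof.
move=> UU; apply/eigenvalueP; exists (row i U^T).
  rewrite mulmxDr mul_mx_scalar scalerDl; congr (_ + _).
  rewrite -row_mul -mulmxA !mulmxA UU mul1mx row_mul row_diag_mx.
  by rewrite -scalemxAl -rowE.
apply/negP => /eqP U0.
have := congr1 (row i) UU; rewrite row_mul U0 mul0mx => /rowP/(_ i).
by rewrite !mxE eqxx => /eqP; rewrite eq_sym oner_eq0.
Qed.

(** * The generalized eigenvalue problem *)

(** Since [V] is square, [V^T T V = 1] also gives [T V V^T = 1]. *)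
Lemma generalized_eigen_inverse (F : fieldType) (m : nat)
    (M T V : 'M[F]_m) (l : 'rV[F]_m) :
  M \in unitmx -> M *m V = T *m V *m diag_mx l -> V^T *m T *m V = 1%:M ->
  (forall i, l 0 i != 0) /\
  invmx M = V *m diag_mx (\row_i (l 0 i)^-1) *m V^T.
Proof.
move=> uM MV VTV.
have [uVT uV] := mulmx1_unit VTV.
have l0 i : l 0 i != 0.
  have : diag_mx l \in unitmx.
    have <- : V^T *m (M *m V) = diag_mx l by rewrite MV !mulmxA VTV mul1mx.
    by rewrite !unitmx_mul unitmx_tr uV uM.
  by rewrite unitmxE unitfE det_diag => /prodf_neq0/(_ i isT).
split=> //.
have TVV : T *m (V *m V^T) = 1%:M.
  by apply: mulmx1C; rewrite -mulmxA; apply: mulmx1C.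
have E : M *m (V *m diag_mx (\row_i (l 0 i)^-1) *m V^T) = 1%:M.
  rewrite !mulmxA MV -(mulmxA _ (diag_mx l)) mulmx_diag.
  have -> : \row_i (l 0 i * (\row_j (l 0 j)^-1) 0 i) = const_mx 1.
    by apply/rowP => i; rewrite !mxE divff.
  by rewrite diag_const_mx mulmx1 -mulmxA TVV.
by rewrite -[LHS]mulmx1 -E mulKmx.
Qed.

(** * Straight-line programs *)

Lemma run_cat (R : realType) (I : Type) (x : I -> R) regs cs1 cs2 :
  run x regs (cs1 ++ cs2) =
  obind (fun regs' => run x regs' cs2) (run x regs cs1).
Proof.
elim: cs1 regs => [//|c cs1 IH] regs /=.
by case: (eval_instr x regs c).
Qed.

Lemma onth_rcons_size (T : Type) (s : seq T) a :
  onth (rcons s a) (size s) = Some a.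
Proof. by rewrite -cats1 onth_cat ltnn subnn. Qed.

Lemma onth_rcons_lt (T : Type) (s : seq T) a k b :
  onth s k = Some b -> onth (rcons s a) k = Some b.
Proof.
move=> sk; rewrite -cats1 onth_cat.
have : isSome (onth s k) by rewrite sk.
by rewrite onthTE => ->.
Qed.

(** Each block [f j k] is told the index [k] of the first register that it
    writes. *)
Fixpoint blocks (J I : Type) (K : nat) (f : J -> nat -> seq (instr I))
    (js : seq J) (k : nat) : seq (instr I) :=
  if js is j :: js' then f j k ++ blocks K f js' (k + K) else [::].

Lemma size_blocks (J I : Type) (K : nat) (f : J -> nat -> seq (instr I)) js k :
  (forall j k', size (f j k') = K) -> size (blocks K f js k) = (size js * K)%N.
Proof.
move=> sf; elim: js k => [//|j js IH] k /=.
by rewrite size_cat sf IH mulSn.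
Qed.

(** The shared value [a] sits in register 0, which no block overwrites because
    registers are only ever appended; hence the hypothesis on a single block may
    be used at every stage.  The last register of each block, at offset
    [K] within it, is its result. *)
Lemma run_blocks (R : realType) (J I : Type) (x : I -> R) (K : nat)
    (f : J -> nat -> seq (instr I)) (v : J -> R) (a : R) (js : seq J) :
  (forall j regs, onth regs 0 = Some a ->
     exists2 vals, size vals = K &
       run x regs (f j (size regs)) = Some (rcons (regs ++ vals) (v j))) ->
  forall regs, onth regs 0 = Some a ->
  exists2 vals, run x regs (blocks K.+1 f js (size regs)) = Some (regs ++ vals) &
    forall t, onth vals (t * K.+1 + K) = omap v (onth js t).
Proof.
move=> fP; elim: js => [|j js IH] regs a0 /=.
  by exists [::] => [|t]; rewrite ?cats0 ?onth0n.
have [vals1 s1 E1] := fP j regs a0.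
have [|vals2 E2 P2] := IH (rcons (regs ++ vals1) (v j)).
  apply: onth_rcons_lt; rewrite onth_cat.
  by have : isSome (onth regs 0) by [rewrite a0]; rewrite onthTE => ->.
exists (rcons vals1 (v j) ++ vals2).
  rewrite run_cat E1 /= catA -rcons_cat.
  by move: E2; rewrite size_rcons size_cat s1 -addnS.
case=> [|t]; rewrite onth_cat size_rcons s1.
  by rewrite mul0n add0n ltnSn -{1}s1 onth_rcons_size.
rewrite mulSn -addnA ltnNge leq_addr /= addKn.
exact: P2.
Qed.

(** * The program for [r] *)

(* Register lookups are resolved by rewriting, never by computing on the
   symbolic register numbers. *)
#[local] Arguments onth : simpl never.

(** The accumulator is the register just before [k]; subtracting instead of
    adding provides the minus sign of [r] at no cost. *)
Fixpoint subdot (m : nat) (i : 'I_m) (js : seq 'I_m) (k : nat) :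
    seq (instr (datum m)) :=
  if js is j :: js' then
    [:: Instr Mul (Inp (In_V j i)) (Inp (In_ubar j));
        Instr Defs.Sub (Reg _ k.-1) (Reg _ k)] ++ subdot i js' k.+2
  else [::].

Lemma size_subdot (m : nat) (i : 'I_m) js k :
  size (subdot i js k) = (2 * size js)%N.
Proof. by elim: js k => [//|j js IH] k /=; rewrite IH; lia. Qed.

Lemma run_subdot (R : realType) (m : nat) (V Lambda : 'M[R]_m)
    (gamma lambda : R) (ubar : 'cV[R]_m) (i : 'I_m) (js : seq 'I_m) regs a :
  exists2 vals, size vals = (2 * size js)%N &
    run (data V Lambda gamma lambda ubar) (rcons regs a)
      (subdot i js (size regs).+1) =
    Some (rcons (regs ++ vals) (a - \sum_(j <- js) V j i * ubar j 0)).
Proof.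
elim: js regs a => [|j js IH] regs a.
  by exists [::] => //; rewrite big_nil subr0 cats0.
have [vals sv E] :=
  IH (rcons (rcons regs a) (V j i * ubar j 0)) (a - V j i * ubar j 0).
exists ([:: a; V j i * ubar j 0] ++ vals); first by rewrite /= sv; lia.
rewrite -(size_rcons regs a) /= /eval_instr /= onth_rcons_size.
rewrite [in onth _ _.-1]size_rcons (onth_rcons_lt _ (onth_rcons_size _ _)) /=.
move: E; rewrite !size_rcons => ->.
by rewrite big_cons opprD addrA -!cats1 -!catA.
Qed.

Definition coord_program (m : nat) (i : 'I_m) (k : nat) :
    seq (instr (datum m)) :=
  let w := (k + 2 * m)%N in
  Instr Defs.Sub (Cst _ 0) (Cst _ 0) :: subdot i (enum 'I_m) k.+1 ++
  [:: Instr Mul (Reg _ 0) (Inp (In_Lambda i i));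
      Instr Add (Reg _ w.+1) (Cst _ 1);
      Instr Mul (Reg _ 0) (Reg _ w.+2);
      Instr Div (Reg _ w) (Reg _ w.+3)].

Lemma size_coord_program (m : nat) (i : 'I_m) k :
  size (coord_program i k) = (2 * m + 5)%N.
Proof. by rewrite /= size_cat size_subdot size_enum_ord /=; lia. Qed.

Lemma run_coord (R : realType) (m : nat) (V Lambda : 'M[R]_m)
    (gamma lambda : R) (ubar : 'cV[R]_m) (a : R) (i : 'I_m) regs :
  a * (a * Lambda i i + 1) != 0 -> onth regs 0 = Some a ->
  exists2 vals, size vals = (2 * m + 4)%N &
    run (data V Lambda gamma lambda ubar) regs (coord_program i (size regs)) =
    Some (rcons (regs ++ vals)
      ((- \sum_j V j i * ubar j 0) / (a * (a * Lambda i i + 1)))).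
Proof.
move=> al0 a0; rewrite /coord_program /= /eval_instr /= subr0.
have [vals sv E] :=
  run_subdot V Lambda gamma lambda ubar i (enum 'I_m) regs 0%:~R.
rewrite run_cat E /= sub0r big_enum /=.
rewrite size_enum_ord in sv.
set w := - _; set l := Lambda i i.
set s0 := rcons _ w.
have s0a : onth s0 0 = Some a.
  apply: onth_rcons_lt; rewrite onth_cat.
  by have : isSome (onth regs 0) by [rewrite a0]; rewrite onthTE => ->.
have s0w : onth s0 (size regs + 2 * m) = Some w.
  by rewrite -sv -size_cat onth_rcons_size.
have ss0 : (size regs + 2 * m).+1 = size s0.
  by rewrite size_rcons size_cat sv.
rewrite /eval_instr /= s0a /= ss0 onth_rcons_size /=.
rewrite (onth_rcons_lt _ (onth_rcons_lt _ s0a)) /=.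
rewrite -(size_rcons s0 (a * l)) onth_rcons_size /=.
rewrite (onth_rcons_lt _ (onth_rcons_lt _ (onth_rcons_lt _ s0w))) /=.
rewrite -(size_rcons (rcons s0 (a * l)) (a * l + 1)) onth_rcons_size /=.
rewrite (negPf al0).
exists (vals ++ [:: w; a * l; a * l + 1; a * (a * l + 1)]).
  by rewrite size_cat sv.
by rewrite /s0 -!cats1 -!catA.
Qed.

Definition r_program (m : nat) : slp (datum m) m :=
  Slp (Instr Add (Inp (In_lambda m)) (Inp (In_gamma m)) ::
       blocks (2 * m + 5) (@coord_program m) (enum 'I_m) 1)
      (fun i => Reg _ (i.+1 * (2 * m + 5))).

(** The exact cost is [1 + m (2 m + 5)], which equals [8 m^2] for [m = 1]. *)
Lemma r_program_cost (m : nat) :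
  (0 < m)%N -> (slp_cost (r_program m) <= 8 * m ^ 2)%N.
Proof.
move=> m0; rewrite /slp_cost /= size_blocks; last exact: size_coord_program.
by rewrite size_enum_ord; nia.
Qed.

Lemma r_program_computes (R : realType) (m : nat) (V Lambda : 'M[R]_m)
    (gamma lambda : R) (ubar : 'cV[R]_m) (a := lambda + gamma) :
  (forall i, a * (a * Lambda i i + 1) != 0) ->
  slp_computes (data V Lambda gamma lambda ubar) (r_program m)
    (\col_i ((- \sum_j V j i * ubar j 0) / (a * (a * Lambda i i + 1)))).
Proof.
move=> al0.
have [//|vals E P] := @run_blocks R 'I_m (datum m)
  (data V Lambda gamma lambda ubar) (2 * m + 4) (@coord_program m)
  (fun i => (- \sum_j V j i * ubar j 0) / (a * (a * Lambda i i + 1)))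
  a (enum 'I_m)
  (fun i regs => @run_coord R m V Lambda gamma lambda ubar a i regs (al0 i))
  [:: a].
exists (a :: vals).
  by move: E; rewrite /= -addnS.
move=> i; have := P i; rewrite /= mxE.
have -> : onth (enum 'I_m) i = Some i.
  by rewrite onthE (nth_map i) ?size_enum_ord // nth_ord_enum.
(* The outer successor skips register 0, which holds [alpha]. *)
by have -> : (i.+1 * (2 * m + 5) = (i * (2 * m + 4).+1 + (2 * m + 4)).+1)%N by nia.
Qed.

(** * The theorem *)

Theorem theorem3 (R : realType) :
  exists (C : nat) (P : forall m : nat, slp (datum m) m),
    (forall m : nat, (0 < m)%N -> (slp_cost (P m) <= C * m ^ 2)%N) /\
    forall (m n : nat), (0 < m)%N -> (m < n)%N ->
    forall (gamma : R) (Psi : 'M[R]_(n, m)) (M : 'M[R]_m),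
    \rank Psi = m -> M^T = M -> M \in unitmx ->
    let B : 'M[R]_n := gamma%:M + Psi *m invmx M *m Psi^T in
    forall lambda1 : R, smallest_eigenvalue B lambda1 ->
    forall g : 'cV[R]_n,
    let T : 'M[R]_m := Psi^T *m Psi in
    let ubar : 'cV[R]_m := Psi^T *m g in
    forall V Lambda : 'M[R]_m,
    is_diag_mx Lambda -> M *m V = T *m V *m Lambda -> V^T *m T *m V = 1%:M ->
    forall lambda : R, Num.max 0 (- lambda1) < lambda ->
    [/\ B + lambda%:M \in unitmx,
        lambda + gamma != 0 &
        exists2 r : 'cV[R]_m,
          slp_computes (data V Lambda gamma lambda ubar) (P m) r &
          - (invmx (B + lambda%:M) *m g)
            = - ((lambda + gamma)^-1 *: g) - Psi *m V *m r].
Proof.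
exists 8, r_program; split; first exact: r_program_cost.
move=> m n m_gt0 mn gamma Psi M _ _ uM B lambda1 [_ lambda1_min] g T ubar V Lambda.
move=> /diag_mxP[l ->] MV VTV lambda; rewrite gt_max => /andP[_ lambda_gt].
have [l0 invM] := generalized_eigen_inverse uM MV VTV.
set U := Psi *m V; set a := lambda + gamma.
have UU : U^T *m U = 1%:M by rewrite trmx_mul mulmxA -(mulmxA V^T).
have BE : B = gamma%:M + U *m diag_mx (\row_i (l 0 i)^-1) *m U^T.
  by rewrite /B invM trmx_mul !mulmxA.
have a_gt0 : 0 < a.
  suff : lambda1 <= gamma by rewrite /a; lra.
  exact/lambda1_min/eigenvalue_scalar_plus_low_rank.
have al_gt0 i : 0 < a + (l 0 i)^-1.
  suff : lambda1 <= gamma + (l 0 i)^-1 by rewrite /a; lra.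
  apply: lambda1_min; rewrite BE.
  have := eigenvalue_scalar_plus_sandwich gamma (\row_i (l 0 i)^-1) i UU.
  by rewrite mxE.
have a0 : a != 0 by rewrite gt_eqF.
have al0 i : a * l 0 i + 1 != 0.
  have -> : a * l 0 i + 1 = l 0 i * (a + (l 0 i)^-1).
    by field; rewrite l0.
  by rewrite mulf_neq0 ?l0 ?gt_eqF.
have BlE : B + lambda%:M = a%:M + U *m diag_mx (\row_i (l 0 i)^-1) *m U^T.
  by rewrite BE addrAC -raddfD /= [gamma + _]addrC.
have inv := scalar_plus_sandwich_inverse UU a0 l0 al0.
have [uBl _] := mulmx1_unit inv.
rewrite -BlE in inv uBl.
split=> //.
eexists.
  apply: r_program_computes => i.
  by rewrite mxE eqxx mulr1n mulf_neq0 ?al0.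
rewrite -[invmx _]mulmx1 -inv mulKmx // mulmxDl mul_scalar_mx opprD.
congr (_ - _); rewrite -!mulmxA; congr (_ *m (_ *m _)).
rewrite trmx_mul -(mulmxA V^T) -/ubar mul_diag_mx.
apply/colP => i; rewrite !mxE eqxx mulr1n !mulNr [X in - X = _]mulrC.
congr (- (_ / _)).
by apply: eq_bigr => j _; rewrite mxE.
Qed.
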